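(* Let $U\subseteq \mathbb{C}$ be a non-empty open subset and let $M\subseteq \mathbb{C}\setminus\{0\}$ be a set with $e^U:=\{e^z : z\in U\}\subseteq M$. For $k\in\mathbb{N}_0$, let $E_k\subseteq \mathbb{C}^{\mathbb{N}}$ be the complex vector subspace spanned by the functions $h_{j,z}\colon \mathbb{N}\to\mathbb{C}$, $h_{j,z}(n):=n^j z^n$, with $z\in M$ and $j\in\mathbb{N}_0$ such that $j\le k$. Give $E_k$ the topology induced by the direct product $\mathbb{C}^{\mathbb{N}}$, and define $$f_k\colon U\to E_k,\qquad f_k(z):=(e^{nz})_{n\in\mathbb{N}}.$$ Then for each $k\in\mathbb{N}$, the map $f_k\colon U\to E_k$ is $C^k_{\mathbb{C}}$ but not $C^{k+1}_{\mathbb{C}}$ (and hence not complex analytic). Furthermore, $f_0\colon U\to E_0$ is weakly analytic but not $C^1_{\mathbb{C}}$ (and hence not complex analytic).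
   Context: $\mathbb{N}=\{1,2,\ldots\}$ and $\mathbb{N}_0=\mathbb{N}\cup\{0\}$. $\mathbb{C}^{\mathbb{N}}$ is the space of all complex sequences with the product topology. Let $f\colon U\to F$ be a continuous map from an open set $U\subseteq\mathbb{C}$ to a complex locally convex space $F$ (no completeness assumed). - $f$ is $C^1_{\mathbb{C}}$ if the complex derivative $f^{(1)}(z)=f'(z)=\frac{df}{dz}(z)$ exists in $F$ for each $z\in U$ and $f'\colon U\to F$ is continuous. For $k\in\mathbb{N}_0$, $f$ is $C^k_{\mathbb{C}}$ if it has continuous complex derivatives $f^{(j)}\colon U\to F$ for all $j\in\mathbb{N}_0$ with $j\le k$, where $f^{(0)}:=f$ and $f^{(j)}:=(f^{(j-1)})'$. - $f$ is complex analytic if for each $z_0\in U$ there are elements $a_n\in F$ ($n\in\mathbb{N}_0$) such that $f(z)=\sum_{n=0}^\infty (z-z_0)^n a_n$ (convergent in $F$) for all $z$ close to $z_0$. - $f$ is weakly analytic if $\lambda\circ f\colon U\to\mathbb{C}$ is complex analytic for each continuous linear functional $\lambda\colon F\to\mathbb{C}$. *)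

(* Defs.v *)
From HB Require Import structures.
From mathcomp Require Import all_boot all_order all_algebra complex.
From mathcomp Require Import all_classical all_reals all_analysis.
From mathcomp Require Import ring.

Set Implicit Arguments.
Unset Strict Implicit.
Unset Printing Implicit Defensive.

Import Order.TTheory GRing.Theory Num.Theory.
Import numFieldNormedType.Exports.

Local Open Scope classical_set_scope.
Local Open Scope ring_scope.

(* The library puts no topology on [R[i]] itself, but its regular module
   [R[i]^o], convertible to it, is a locally convex space over [R[i]]. *)
Notation Cplx R := ((complex R)^o).

(* The elements of [lspan S] are the finite sums of [p.1 *: p.2] with
   [p.2] in [S]. *)
Definition lspan {K : pzRingType} {V : lmodType K} (S : set V) : {pred V} :=
  fun x => `[< exists2 s : seq (K * V), (forall p, p \in s -> S p.2) &
                 x = \sum_(p <- s) p.1 *: p.2 >].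

Section span_space.
Context {K : numFieldType} {V : tvsType K} (S : set V).

Lemma lspan_submod_closed : submod_closed (lspan S).
Proof.
split; first by apply/asboolP; exists [::] => //; rewrite big_nil.
move=> a u v /asboolP[s sS ->] /asboolP[t tS ->]; apply/asboolP.
exists ([seq (a * p.1, p.2) | p <- s] ++ t).
  by move=> p; rewrite mem_cat => /orP[/mapP[q /sS qS ->]|/tS].
rewrite big_cat big_map scaler_sumr; congr (_ + _).
by apply: eq_bigr => p _; rewrite scalerA.
Qed.

HB.instance Definition _ :=
  GRing.isSubmodClosed.Build K V (lspan S) lspan_submod_closed.

Definition span_space := {x : V | x \in lspan S}.

HB.instance Definition _ := [isSub of span_space for sval].
HB.instance Definition _ := [Choice of span_space by <:].
HB.instance Definition _ := [SubChoice_isSubLmodule of span_space by <:].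
HB.instance Definition _ :=
  Uniform.copy span_space (initial_topology (val : span_space -> V)).

Lemma span_val_continuous : continuous (val : span_space -> V).
Proof. exact: initial_continuous. Qed.

Lemma span_continuous (X : topologicalType) (g : X -> span_space) :
  continuous (val \o g) -> continuous g.
Proof. exact: continuous_comp_initial. Qed.

Let span_add_continuous :
  continuous (fun x : span_space * span_space => x.1 + x.2).
Proof.
apply: span_continuous => x.
apply: (@continuous_comp _ _ _ (fun x : span_space * span_space =>
  (val x.1, val x.2)) (fun x : V * V => x.1 + x.2)); last exact: add_continuous.
apply: cvg_pair => /=.
  by apply: (continuous_comp cvg_fst); exact: span_val_continuous.
by apply: (continuous_comp cvg_snd); exact: span_val_continuous.
Qed.

Let span_scale_continuous :
  continuous (fun z : K^o * span_space => z.1 *: z.2).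
Proof.
apply: span_continuous => x.
apply: (@continuous_comp _ _ _ (fun x : K^o * span_space =>
  (x.1, val x.2)) (fun x : K^o * V => x.1 *: x.2)); last exact: scale_continuous.
apply: (@cvg_pair _ _ _ _ (nbhs (x.1 : K^o)) (nbhs (val x.2 : V))) => /=.
  exact: cvg_fst.
by apply: (continuous_comp cvg_snd); exact: span_val_continuous.
Qed.

Let span_locally_convex :
  exists2 B : set_system span_space,
    (forall b, b \in B -> convex_set b) & basis B.
Proof.
have [B Bcvx [Bop Bnbhs]] := @locally_convex K V.
exists [set val @^-1` b | b in B].
  move=> _ /set_mem[b Bb <-] x y l; rewrite !inE => bx by_.
  have := Bcvx b (mem_set Bb) (val x) (val y) l (mem_set bx) (mem_set by_).
  by rewrite inE.
split; first by move=> _ [b /Bop bop <-]; exists b.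
move=> x A [_ [[W Wop <-] Wx WA]].
have [b [Bb bx] bW] := Bnbhs (val x) W (open_nbhs_nbhs (conj Wop Wx)).
exists (val @^-1` b); first by split => //; exists b.
by move=> y /bW Wy; apply: WA.
Qed.

HB.instance Definition _ := PreTopologicalNmodule_isTopologicalNmodule.Build
  span_space span_add_continuous.
HB.instance Definition _ := TopologicalNmodule_isTopologicalLmodule.Build
  K span_space span_scale_continuous.
HB.instance Definition _ :=
  Uniform_isTvs.Build K span_space span_locally_convex.

End span_space.

(* The space of sequences indexed by [{1, 2, ...}], with the product topology:
   [x n] is the entry of index [n.+1]. *)
Definition seq_space (K : numFieldType) : Type := nat -> K^o.

Section seq_space.
Context (K : numFieldType).

HB.instance Definition _ := GRing.Lmodule.copy (seq_space K) (nat -> K^o).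
HB.instance Definition _ :=
  Uniform.copy (seq_space K) (prod_topology (fun _ : nat => K^o)).

Lemma seq_space_cvgP (F : set_system (seq_space K)) (x : seq_space K) :
  Filter F -> F --> x <-> forall i, (fun y : seq_space K => y i) @ F --> x i.
Proof.
move=> FF; split=> [Fx i|Fx].
  apply: cvg_trans (cvg_app _ Fx) _.
  exact: (@proj_continuous nat (fun=> K^o : topologicalType) i x).
apply/(@cvg_sup (seq_space K) nat (fun i => Topological.class
  (initial_topology (fun f : seq_space K => f i)))) => i.
move=> A [_ [[W Wop <-] Wx WA]]; apply: filterS WA _.
exact: (Fx i W (open_nbhs_nbhs (conj Wop Wx))).
Qed.

Lemma seq_proj_continuous (i : nat) : continuous (fun x : seq_space K => x i).
Proof. by move=> x; have /seq_space_cvgP := @cvg_id _ (nbhs x); exact. Qed.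

Let seq_add_continuous :
  continuous (fun x : seq_space K * seq_space K => x.1 + x.2).
Proof.
move=> x; apply/seq_space_cvgP => i.
apply: (@continuous_comp _ _ _ (fun x : seq_space K * seq_space K =>
  (x.1 i, x.2 i)) (fun x : K^o * K^o => x.1 + x.2)); last exact: add_continuous.
apply: (@cvg_pair _ _ _ _ (nbhs (x.1 i : K^o)) (nbhs (x.2 i : K^o))) => /=.
  by apply: (@continuous_comp _ _ _ fst (fun y : seq_space K => y i));
    [exact: cvg_fst|exact: seq_proj_continuous].
by apply: (@continuous_comp _ _ _ snd (fun y : seq_space K => y i));
    [exact: cvg_snd|exact: seq_proj_continuous].
Qed.

Let seq_scale_continuous :
  continuous (fun z : K^o * seq_space K => z.1 *: z.2).
Proof.
move=> x; apply/seq_space_cvgP => i.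
apply: (@continuous_comp _ _ _ (fun x : K^o * seq_space K =>
  (x.1, x.2 i)) (fun x : K^o * K^o => x.1 *: x.2)); last exact: scale_continuous.
apply: (@cvg_pair _ _ _ _ (nbhs (x.1 : K^o)) (nbhs (x.2 i : K^o))) => /=.
  exact: cvg_fst.
by apply: (@continuous_comp _ _ _ snd (fun y : seq_space K => y i));
    [exact: cvg_snd|exact: seq_proj_continuous].
Qed.

Let seq_locally_convex :
  exists2 B : set_system (seq_space K),
    (forall b, b \in B -> convex_set b) & basis B.
Proof.
have [B Bcvx [Bop Bnbhs]] := @locally_convex K K^o.
exists [set A | open A /\ convex_set A].
  by move=> A /set_mem[].
split=> [A []//|x].
have FG : Filter (filter_from
    [set A | [set A | open A /\ convex_set A] A /\ A x] id).
  apply: filter_from_filter.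
    by exists setT; split => //; split; [exact: openT|move=> *; rewrite inE].
  move=> A C [[Aop Acvx] Ax] [[Cop Ccvx] Cx]; exists (A `&` C) => //.
  split=> //; split; first exact: openI.
  move=> u v l; rewrite !inE => -[Au Cu] [Av Cv]; split.
    by apply: set_mem; apply: Acvx; exact: mem_set.
  by apply: set_mem; apply: Ccvx; exact: mem_set.
apply/seq_space_cvgP => i A Axi.
have [b [Bb bx] bA] := Bnbhs (x i) A Axi.
exists ((fun y : seq_space K => y i) @^-1` b); last by move=> y /bA.
split=> //; split.
  by apply: open_comp; [move=> y _; exact: seq_proj_continuous|exact: Bop].
move=> u v l; rewrite !inE => bu bv.
by have := Bcvx b (mem_set Bb) (u i) (v i) l (mem_set bu) (mem_set bv);
  rewrite inE.
Qed.

HB.instance Definition _ := PreTopologicalNmodule_isTopologicalNmodule.Build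
  (seq_space K) seq_add_continuous.
HB.instance Definition _ := TopologicalNmodule_isTopologicalLmodule.Build
  K (seq_space K) seq_scale_continuous.
HB.instance Definition _ :=
  Uniform_isTvs.Build K (seq_space K) seq_locally_convex.

End seq_space.

Section complex_maps.
Context {R : realType} {F : tvsType R[i]}.
Implicit Types (U : set (Cplx R)) (f : Cplx R -> F).

(* Only the values of the maps on [U] matter below. *)

Definition is_cderive f (z : Cplx R) (l : F) :=
  (h : R[i])^-1 *: (f (z + h) - f z) @[h --> (0 : Cplx R)^'] --> l.

(* [g j] is the [j]-th complex derivative of [f] on [U]. *)
Definition CkC (k : nat) U f :=
  exists g : nat -> Cplx R -> F,
    [/\ g 0%N = f,
        forall j, (j < k)%N -> forall z, U z -> is_cderive (g j) z (g j.+1 z) &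
        forall j, (j <= k)%N -> {within U, continuous (g j)}].

Definition complex_analytic U f :=
  {within U, continuous f} /\
  forall z0, U z0 -> exists a : nat -> F,
    \forall z \near z0,
      series (fun n => (z - z0 : R[i]) ^+ n *: a n) @ \oo --> f z.

End complex_maps.

Definition weakly_analytic {R : realType} {F : tvsType R[i]}
    (U : set (Cplx R)) (f : Cplx R -> F) :=
  {within U, continuous f} /\
  forall lambda : {linear F -> Cplx R}, continuous lambda ->
    complex_analytic U (lambda \o f).

Section exponential_spaces.
Context {R : realType}.
Implicit Types (M : set (Cplx R)) (z w : R[i]) (j k : nat).

Definition cexp z : R[i] :=
  (expR (complex.Re z))%:C%C *
  (cos (complex.Im z) +i* sin (complex.Im z))%C.

Definition hseq j z : seq_space R[i] := fun n => n.+1%:R ^+ j * z ^+ n.+1.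

Definition hset M k : set (seq_space R[i]) :=
  [set x | exists j z, [/\ (j <= k)%N, M z & x = hseq j z]].

Definition Espace M k := span_space (hset M k).

Definition expseq z : seq_space R[i] := fun n => cexp (n.+1%:R * z).

(* [expseq z] belongs to [Espace M k] as soon as [M (cexp z)] (see
   [val_expmap]); the value [0] is used otherwise. *)
Definition expmap M k (z : Cplx R) : Espace M k := insubd 0 (expseq z).

Lemma cexpD z w : cexp (z + w) = cexp z * cexp w.
Proof.
case: z w => [a b] [c d]; rewrite /cexp/= expRD cosD sinD.
apply/eqP; rewrite eq_complex/=; apply/andP; split; apply/eqP; ring.
Qed.

Lemma cexpMn n z : cexp (n.+1%:R * z) = cexp z ^+ n.+1.
Proof.
elim: n => [|n IHn]; first by rewrite mul1r expr1.
by rewrite -natr1 mulrDl mul1r cexpD IHn -exprSr.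
Qed.

Lemma val_expmap M k z : M (cexp z) -> val (expmap M k z) = expseq z.
Proof.
move=> Mz; rewrite insubdK//; apply/asboolP.
exists [:: (1, hseq 0%N (cexp z))].
  by move=> p; rewrite inE => /eqP -> /=; exists 0%N, (cexp z).
rewrite big_seq1 scale1r; apply/funext => n.
by rewrite /= /expseq /hseq expr0 mul1r cexpMn.
Qed.

End exponential_spaces.

(* Main.v *)
(* Coordinatewise [e^(nz)] has [j]-th derivative [n^j e^(nz)], and in the product
   topology limits are taken coordinatewise, so everything depends on whether
   [n^j w^n], with [w = e^z], belongs to [E_k]. For [j <= k] it does by
   definition. For [j = k + 1] and [w <> 0] it does not: with [theta = X d/dX],
   a polynomial [p] pairs with [n^j z^n] to [theta^j (X p) (z)]; if [p] vanishes
   to order exactly [k + 1] at [w] and to order [k + 1] at the other points [z]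
   occurring in a linear combination, it kills the combination but not
   [n^(k+1) w^n]. Both a [(k+1)]-st derivative and the coefficient of index
   [k + 1] of a power series expansion in [E_k] would be nonzero multiples of
   this sequence. Finally a continuous functional depends on finitely many
   coordinates only, hence maps [f_0] to a linear combination of the analytic
   functions [e^(nz)]. *)

Require Import Defs.
From mathcomp Require Import all_boot all_order all_algebra complex.
From mathcomp Require Import all_classical all_reals all_analysis.
From mathcomp Require Import ring.

Set Implicit Arguments.
Unset Strict Implicit.
Unset Printing Implicit Defensive.

Import Order.TTheory GRing.Theory Num.Theory.
Import numFieldNormedType.Exports.

Local Open Scope classical_set_scope.
Local Open Scope ring_scope.

Lemma cvg_near_eq {T : Type} {X : topologicalType} (F : set_system T)
    {FF : Filter F} (f g : T -> X) (l : X) :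
  (\forall t \near F, f t = g t) -> f @ F --> l -> g @ F --> l.
Proof.
by move=> fg fl A Al; apply: filterS2 fg (fl A Al) => t /= ->.
Qed.

(** * Scalar power series near the centre: value, derivative, uniqueness *)

Section power_series.
Context {K : numFieldType}.
Implicit Types (b c : nat -> K^o) (f : K^o -> K^o) (h : K^o).

Definition pseries_to b h (l : K^o) :=
  series (fun n => h ^+ n * b n : K^o) @ \oo --> l.

Lemma le_norm_cvg (u : nat -> K^o) (l a e : K^o) :
  u @ \oo --> l -> (\forall n \near \oo, `|u n - a| <= e) -> `|l - a| <= e.
Proof.
move=> ul ue; apply/ler_addgt0Pr => d d0.
have ld : \forall n \near \oo, `|l - u n| <= d by apply: (cvgrPdist_le _ _).1 ul d d0.
have /filter_ex[n [un dn]] :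
    \forall n \near \oo, `|u n - a| <= e /\ `|l - u n| <= d by apply: filterI.
rewrite (le_trans (ler_distD (u n) _ _))// [e + d]addrC; exact: lerD.
Qed.

Lemma pseries_terms_bounded b h l : pseries_to b h l ->
  exists2 B : K, 0 <= B & forall n, `|h| ^+ n * `|b n| <= B.
Proof.
move=> bl.
have h0 : (fun n => h ^+ n * b n : K^o) @ \oo --> (0 : K^o).
  by apply: cvg_series_cvg_0; apply/cvg_ex; exists l.
have [B [Br]] : bounded_fun (fun n => h ^+ n * b n : K^o).
  by apply: cvg_seq_bounded; apply/cvg_ex; exists 0.
move=> /(_ (B + 1)); rewrite ltrDl ltr01 => /(_ isT) BP.
exists (B + 1) => [|n]; last by rewrite -normrX -normrM; exact: BP.
by apply: le_trans (BP 0%N I).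
Qed.

(** Comparison with a geometric series: the terms at one point [r != 0] of convergence are bounded
    by some [B], so for [|h| <= |r| / 2] what follows [b 0] is [O(|h|)]. *)
Lemma pseries_cvg0 b f :
  (\forall h \near (0 : K^o)^', pseries_to b h (f h)) ->
  f h @[h --> (0 : K^o)^'] --> b 0%N.
Proof.
move=> bf.
have /filter_ex[r [bfr r0]] :
    \forall h \near (0 : K^o)^', pseries_to b h (f h) /\ h != 0.
  by apply: filterI => //; exact: (@nbhs_dnbhs_neq K^o).
have [B B0 bB] := pseries_terms_bounded bfr.
have nr0 : 0 < `|r| by rewrite normr_gt0.
(* The term of index [n + 1] is at most [B * (|h| / |r|) * 2^-n]; the right-hand side sums these
   bounds over [n < N]. *)
have partial h N : `|h| <= `|r| / 2 ->
    `|series (fun n => h ^+ n * b n : K^o) N.+1 - b 0%N| <=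
      2 * B * (`|h| / `|r|) * (1 - 2^-1 ^+ N).
  move=> hr; elim: N => [|N IH].
    by rewrite seriesSr /series/= big_geq// add0r expr0 mul1r !subrr normr0 mulr0.
  rewrite seriesSr -addrA [X in _ + X]addrC addrA.
  apply: le_trans (ler_normD _ _) _.
  have -> : 2 * B * (`|h| / `|r|) * (1 - 2^-1 ^+ N.+1) =
    2 * B * (`|h| / `|r|) * (1 - 2^-1 ^+ N) + B * ((`|h| / `|r|) * (2^-1 ^+ N)).
    rewrite exprS; field; by rewrite gt_eqF.
  apply: lerD => //.
  have -> : `|h ^+ N.+1 * b N.+1| =
     (`|r| ^+ N.+1 * `|b N.+1|) * ((`|h| / `|r|) * (`|h| / `|r|) ^+ N).
    rewrite -exprS expr_div_n normrM normrX; field.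
    by rewrite expf_neq0// gt_eqF.
  apply: ler_pM => //; rewrite ?(mulr_ge0, exprn_ge0, divr_ge0)//.
  rewrite ler_wpM2l ?divr_ge0// lerXn2r ?nnegrE ?divr_ge0// ?invr_ge0//.
  by rewrite ler_pdivrMr// mulrC.
apply/cvgrPdist_le => e e0.
(* Adding [1] keeps the constant positive even if [B = 0]. *)
have C0 : 0 < 2 * B / `|r| + 1 by rewrite ltr_pwDr// divr_ge0// mulr_ge0.
have hr : \forall h \near (0 : K^o)^', `|h| <= `|r| / 2.
  by apply: dnbhs0_le; rewrite divr_gt0.
have he : \forall h \near (0 : K^o)^', `|h| <= e / (2 * B / `|r| + 1).
  by apply: dnbhs0_le; rewrite divr_gt0.
near=> h.
have hr' : `|h| <= `|r| / 2 by near: h.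
have he' : `|h| <= e / (2 * B / `|r| + 1) by near: h.
have bh : pseries_to b h (f h) by near: h.
rewrite distrC; apply: (le_norm_cvg bh).
near=> N.
have /prednK <- : (0 < N)%N by near: N; exact: nbhs_infty_gt.
apply: le_trans (partial h _ hr') _.
apply: (@le_trans _ _ ((2 * B / `|r| + 1) * `|h|)); last first.
  by rewrite mulrC -ler_pdivlMr.
rewrite [leRHS]mulrDl mul1r -[leLHS]addr0 lerD//.
have -> : 2 * B / `|r| * `|h| = 2 * B * (`|h| / `|r|) * 1 by ring.
apply: ler_wpM2l; first by rewrite !mulr_ge0// ?invr_ge0.
by rewrite lerBlDr lerDl exprn_ge0// invr_ge0.
Unshelve. all: by end_near. Qed.

Lemma pseries_shift b h (l : K^o) : h != 0 -> pseries_to b h l ->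
  pseries_to (fun n => b n.+1) h (h^-1 * (l - b 0%N)).
Proof.
move=> h0 bl; rewrite /pseries_to.
rewrite [X in X @ _ --> _](_ : _ = fun N =>
   h^-1 * (series (fun n => h ^+ n * b n : K^o) N.+1 - b 0%N) : K^o); last first.
  apply/funext => N; rewrite /series/= big_nat_recl// expr0 mul1r addrAC subrr add0r.
  rewrite big_distrr/=; apply: eq_bigr => n _.
  by rewrite exprS -!mulrA mulKf.
apply: (@cvgMl_tmp K); apply: cvgB; last exact: cvg_cst.
by rewrite (cvg_shiftS (series _)).
Qed.

Lemma pseries_scale b h (l a c : K^o) : pseries_to b (a * h) l ->
  pseries_to (fun n => c * (a ^+ n * b n)) h (c * l).
Proof.
move=> bl; rewrite /pseries_to.
rewrite [X in X @ _ --> _](_ : _ = fun N =>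
   c * series (fun n => (a * h) ^+ n * b n : K^o) N : K^o); last first.
  apply/funext => N; rewrite /series/= big_distrr/=; apply: eq_bigr => n _.
  by rewrite exprMn; ring.
exact: (@cvgMl_tmp K).
Qed.

(** The coefficient of index 0 is the limit at 0; subtracting it and dividing by [h], which is
    nonzero in a punctured neighbourhood, shifts the series for the induction. *)
Lemma pseries_uniq b c f :
  (\forall h \near (0 : K^o)^', pseries_to b h (f h)) ->
  (\forall h \near (0 : K^o)^', pseries_to c h (f h)) ->
  b =1 c.
Proof.
move=> bf cf n; elim: n b c f bf cf => [|n IH] b c f bf cf.
  by apply: (cvg_unique _ (pseries_cvg0 bf) (pseries_cvg0 cf)); exact: norm_hausdorff.
have bc : b 0%N = c 0%N.
  by apply: (cvg_unique _ (pseries_cvg0 bf) (pseries_cvg0 cf)); exact: norm_hausdorff.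
apply: (IH (fun n => b n.+1) (fun n => c n.+1) (fun h => h^-1 * (f h - b 0%N))).
  near=> h; apply: pseries_shift; last by near: h.
  by near: h; exact: (@nbhs_dnbhs_neq K^o).
rewrite bc; near=> h; apply: pseries_shift; last by near: h.
by near: h; exact: (@nbhs_dnbhs_neq K^o).
Unshelve. all: by end_near. Qed.

Lemma pseries_derive b f :
  (\forall h \near (0 : K^o)^', pseries_to b h (f h)) ->
  h^-1 * (f h - b 0%N) @[h --> (0 : K^o)^'] --> b 1%N.
Proof.
move=> bf; apply: (pseries_cvg0 (b := fun n => b n.+1)).
near=> h; apply: pseries_shift; last by near: h.
by near: h; exact: (@nbhs_dnbhs_neq K^o).
Unshelve. all: by end_near. Qed.

Lemma pseries_lincomb N c (b : nat -> nat -> K^o) h (l : nat -> K^o) :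
  (forall n : 'I_N, pseries_to (b n) h (l n)) ->
  pseries_to (fun m => \sum_(n < N) c n * b n m) h (\sum_(n < N) c n * l n).
Proof.
move=> bl; rewrite /pseries_to.
rewrite [X in X @ _ --> _](_ : _ = fun k => \sum_(n < N)
    c n * series (fun m => h ^+ m * b n m : K^o) k : K^o); last first.
  apply/funext => k; rewrite /series/=.
  under [RHS]eq_bigr do rewrite big_distrr/=.
  rewrite exchange_big/=; apply: eq_bigr => m _; rewrite big_distrr/=.
  by apply: eq_bigr => n _; rewrite mulrCA.
apply: (@cvg_big K^o); first exact: add_continuous.
by move=> n _; apply: (@cvgMl_tmp K); exact: bl.
Qed.

End power_series.

(** * The series of the complex exponential *)

Section exponential_series.

Definition inv_fact (K : numFieldType) (n : nat) : K^o := n`!%:R^-1.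

Definition exp_partial (K : numFieldType) (N : nat) (x : K) : K :=
  series (fun n => x ^+ n * inv_fact K n : K^o) N.

Lemma sum_triangle (K : pzRingType) (a b : nat -> K) N :
  \sum_(0 <= n < N) \sum_(0 <= i < n.+1) a i * b (n - i)%N =
  \sum_(0 <= i < N) \sum_(0 <= j < N - i) a i * b j.
Proof.
elim: N => [|N IH]; first by rewrite !big_geq.
rewrite big_nat_recr//= IH.
rewrite [RHS](eq_big_nat _ _ (F2 := fun i =>
  \sum_(0 <= j < N - i) a i * b j + a i * b (N - i)%N)); last first.
  by move=> i /andP[_ iN]; rewrite subSn// big_nat_recr.
rewrite big_split/=; congr (_ + _).
by rewrite big_nat_recr//= subnn [X in _ + X]big_geq// addr0.
Qed.

(** By the binomial formula the products with [i + j < N] add up to [exp_partial N (x + y)]; those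
    with [i + j >= N] remain. *)
Lemma exp_partial_mul (K : numFieldType) N (x y : K) :
  exp_partial N x * exp_partial N y - exp_partial N (x + y) =
  \sum_(0 <= i < N) \sum_(N - i <= j < N)
    (x ^+ i * inv_fact K i) * (y ^+ j * inv_fact K j).
Proof.
have -> : exp_partial N (x + y) =
    \sum_(0 <= i < N) \sum_(0 <= j < N - i)
      (x ^+ i * inv_fact K i) * (y ^+ j * inv_fact K j).
  rewrite -(sum_triangle (fun i => x ^+ i * inv_fact K i)
                         (fun j => y ^+ j * inv_fact K j)).
  apply: eq_bigr => n _; rewrite addrC exprDn big_mkord big_distrl/=.
  apply: eq_bigr => i _; rewrite /inv_fact -mulr_natl.
  have /(congr1 (fun m => m%:R : K)) := bin_fact (leq_ord i).
  rewrite !natrM => <-; field.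
  by rewrite !pnatr_eq0 -!lt0n !fact_gt0 bin_gt0 leq_ord.
apply/eqP; rewrite subr_eq -big_split/=; apply/eqP.
rewrite [LHS]big_distrl/=; apply: eq_bigr => i _.
by rewrite [LHS]big_distrr/= addrC -big_cat_nat//= leq_subr.
Qed.

(* The terms of [exp_partial_mul] are positive when [x] and [y] are, which reduces
   the addition formula for complex arguments to that of the real exponential. *)
Lemma exp_partial_mul_le (K : numFieldType) N (x y : K) :
  `|exp_partial N x * exp_partial N y - exp_partial N (x + y)| <=
  exp_partial N `|x| * exp_partial N `|y| - exp_partial N (`|x| + `|y|).
Proof.
rewrite !exp_partial_mul; apply: le_trans (ler_norm_sum _ _ _) _.
apply: ler_sum => i _; apply: le_trans (ler_norm_sum _ _ _) _.
apply: ler_sum => j _.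
by rewrite !normrM !normrX /inv_fact !normfV !normr_nat.
Qed.

(** The error in the product formula is dominated by the one for [|z|] and [|w|], which is assumed
    to tend to 0. *)
Lemma exp_partial_cvgD (K : numFieldType) (z w a b : K^o) :
  (fun N => exp_partial N `|z| * exp_partial N `|w| -
            exp_partial N (`|z| + `|w|) : K^o) @ \oo --> (0 : K^o) ->
  (fun N => exp_partial N z : K^o) @ \oo --> a ->
  (fun N => exp_partial N w : K^o) @ \oo --> b ->
  (fun N => exp_partial N (z + w) : K^o) @ \oo --> (a * b : K^o).
Proof.
move=> maj0 za wb.
have diff0 : (fun N => exp_partial N z * exp_partial N w -
    exp_partial N (z + w) : K^o) @ \oo --> (0 : K^o).
  apply/cvgr0Pnorm_le => e e0; move/cvgr0Pnorm_le : maj0 => /(_ _ e0).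
  apply: filterS => N; apply: le_trans.
  have le_maj := exp_partial_mul_le N z w.
  have maj_ge0 := le_trans (normr_ge0 _) le_maj.
  by rewrite (ger0_norm maj_ge0).
rewrite -[a * b]subr0.
rewrite [X in X @ _ --> _](_ : _ = fun N => exp_partial N z * exp_partial N w -
    (exp_partial N z * exp_partial N w - exp_partial N (z + w)) : K^o).
  exact: (cvgB (cvgM za wb) diff0).
by apply/funext => N; rewrite subKr.
Qed.

Context {R : realType}.
Implicit Types (z w : Cplx R) (t : R).

Lemma norm_realC t : `|t%:C%C : R[i]| = `|t|%:C%C.
Proof. by rewrite normc_def/= expr0n addr0 sqrtr_sqr. Qed.

Lemma cvg_realC (u : nat -> R^o) (l : R^o) : u @ \oo --> l ->
  (fun n => (u n)%:C%C : Cplx R) @ \oo --> (l%:C%C : Cplx R).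
Proof.
move=> ul; apply/cvgrPdist_lt => e e0.
(* Positive elements of [R[i]] are real. *)
have er : e = (complex.Re e)%:C%C by rewrite RRe_real// gtr0_real.
have re0 : 0 < complex.Re e by rewrite -ltcR -er.
move/cvgrPdist_lt : ul => /(_ _ re0); apply: filterS => n.
by rewrite er -rmorphB/= norm_realC ltcR.
Qed.

Lemma exp_partial_real t N :
  exp_partial N (t%:C%C : R[i]) = (series (exp_coeff t) N)%:C%C.
Proof.
rewrite /exp_partial /series/= rmorph_sum/=; apply: eq_bigr => n _.
by rewrite rmorphM rmorphXn/= fmorphV/= rmorph_nat.
Qed.

Lemma exp_partial_real_cvg t :
  (fun N => exp_partial N (t%:C%C : R[i]) : Cplx R) @ \oo -->
  ((expR t)%:C%C : Cplx R).
Proof.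
under eq_fun do rewrite exp_partial_real.
by apply: cvg_realC; exact: is_cvg_series_exp_coeff.
Qed.

Lemma exp_partial_imag_cvg t :
  (fun N => exp_partial N ('i%C * t%:C%C : R[i]) : Cplx R) @ \oo -->
  ((cos t +i* sin t)%C : Cplx R).
Proof.
(* The parity of [n] separates cosine from sine terms; the exponents are those of [cos_coeff] and
   [sin_coeff]. *)
have iX n : 'i%C ^+ n = ((~~ odd n)%:R * (-1) ^+ n./2)%:C%C +
                        'i%C * ((odd n)%:R * (-1) ^+ n.-1./2)%:C%C :> R[i].
  rewrite -{1}(odd_double_half n) exprD -mul2n exprM sqr_i.
  have signC m : (-1) ^+ m = ((-1) ^+ m)%:C%C :> R[i].
    by rewrite rmorphXn/= rmorphN1.
  rewrite signC; case: (boolP (odd n)) => on.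
    have -> : n.-1./2 = n./2.
      by case: n on => //= n /negbTE on; rewrite uphalf_half on.
    by rewrite expr1 mul0r mul1r rmorph0 add0r.
  by rewrite expr0 mul0r !mul1r rmorph0 mulr0 addr0.
rewrite [X in X @ _ --> _](_ : _ = fun N =>
    (series (cos_coeff t) N)%:C%C + 'i%C * (series (sin_coeff t) N)%:C%C :> Cplx R); last first.
  apply/funext => N; rewrite /exp_partial /series/= !rmorph_sum/= mulr_sumr.
  rewrite -big_split/=; apply: eq_bigr => n _.
  rewrite exprMn iX !rmorphM/= !fmorphV/= !rmorph_nat !rmorphXn/= /inv_fact.
  ring.
rewrite [(cos t +i* sin t)%C]complexE/=.
have cosC : (fun N => (series (cos_coeff t) N)%:C%C : Cplx R) @ \oo -->
    ((cos t)%:C%C : Cplx R).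
  by apply: cvg_realC; rewrite cos.unlock; exact: is_cvg_series_cos_coeff.
have sinC : (fun N => (series (sin_coeff t) N)%:C%C : Cplx R) @ \oo -->
    ((sin t)%:C%C : Cplx R).
  by apply: cvg_realC; rewrite sin.unlock; exact: is_cvg_series_sin_coeff.
exact: (cvgD cosC (@cvgMl_tmp R[i] _ _ _ _ _ _ sinC)).
Qed.

(** As [cexp] is built from real functions, the series is summed at the real part and at [i] times
    the imaginary part, then recombined by the addition formula. *)
Lemma cexp_series z : pseries_to (inv_fact R[i]) z (cexp z).
Proof.
(* The norms are read as real numbers, so that the majorant is controlled by the real
   exponential. *)
pose r := complex.Re `|(complex.Re z)%:C%C : R[i]|.
pose s := complex.Re `|'i%C * (complex.Im z)%:C%C : R[i]|.
rewrite [z in pseries_to _ z _]complexE; apply: exp_partial_cvgD.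
- have -> : `|(complex.Re z)%:C%C : R[i]| = r%:C%C by rewrite /r RRe_real.
  have -> : `|'i%C * (complex.Im z)%:C%C : R[i]| = s%:C%C by rewrite /s RRe_real.
  rewrite -rmorphD/=; under eq_fun do rewrite !exp_partial_real -rmorphM -rmorphB/=.
  apply: cvg_realC; rewrite -(subrr (expR (r + s))) {1}expRD.
  have cvg_exp t : series (exp_coeff t) @ \oo --> (expR t : R^o).
    exact: is_cvg_series_exp_coeff.
  by apply: cvgB => //; apply: cvgM.
- exact: exp_partial_real_cvg.
- exact: exp_partial_imag_cvg.
Qed.

End exponential_series.

(** * Expansion and derivatives of the coordinates *)

Section exponential_entries.
Context {R : realType}.
Implicit Types (z h : Cplx R) (n j : nat).

(** The [j]-th derivative of [e^((n+1)z)]: entry [n] of a sequence has index [n + 1]. *)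
Definition exp_entry n j z : Cplx R := n.+1%:R ^+ j * cexp (n.+1%:R * z).

Lemma exp_entry_series n j z h :
  pseries_to (fun m => exp_entry n j z * (n.+1%:R ^+ m * inv_fact R[i] m)) h
    (exp_entry n j (z + h)).
Proof.
have -> : exp_entry n j (z + h) = exp_entry n j z * cexp (n.+1%:R * h).
  by rewrite /exp_entry mulrDr cexpD mulrA.
exact: (@pseries_scale R[i] _ _ _ _ _ (@cexp_series R _)).
Qed.

Lemma exp_entry_series_near n j z : \forall h \near (0 : Cplx R)^',
  pseries_to (fun m => exp_entry n j z * (n.+1%:R ^+ m * inv_fact R[i] m)) h
    (exp_entry n j (z + h)).
Proof. by apply: nearW => h; exact: exp_entry_series. Qed.

Lemma exp_entry_continuous n j : continuous (exp_entry n j).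
Proof.
move=> z.
suff : (exp_entry n j \o shift z) x @[x --> (0 : Cplx R)] --> exp_entry n j z.
  by rewrite cvg_comp_shift add0r.
have -> : exp_entry n j \o shift z = fun h => exp_entry n j (z + h).
  by apply/funext => h; rewrite /= addrC.
rewrite -[X in _ --> exp_entry _ _ X]addr0.
apply/(continuous_withinNx (fun h => exp_entry n j (z + h))).
have := pseries_cvg0 (exp_entry_series_near n j z).
by rewrite addr0 /inv_fact expr0 invr1 !mulr1.
Qed.

Lemma exp_entry_derive n j z :
  (h : R[i])^-1 * (exp_entry n j (z + h) - exp_entry n j z)
    @[h --> (0 : Cplx R)^'] --> exp_entry n j.+1 z.
Proof.
have := pseries_derive (exp_entry_series_near n j z).
have -> : exp_entry n j z * (n.+1%:R ^+ 0 * inv_fact R[i] 0) = exp_entry n j z.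
  by rewrite /inv_fact expr0 invr1 !mulr1.
have -> // : exp_entry n j z * (n.+1%:R ^+ 1 * inv_fact R[i] 1) =
  exp_entry n j.+1 z.
by rewrite /inv_fact invr1 expr1 mulr1 /exp_entry exprS mulrC mulrA.
Qed.
End exponential_entries.

(** * Independence of the sequences [n^j z^n], by polynomials with prescribed zeros *)

Section linear_independence.
Context {K : numFieldType}.
Implicit Types (p q : {poly K}) (z w : K).

Definition euler_op p := 'X * p^`().

Lemma coef_iter_euler j p i : (iter j euler_op p)`_i = i%:R ^+ j * p`_i.
Proof.
elim: j => [|j IH]; first by rewrite expr0 mul1r.
rewrite iterS /euler_op coefXM; case: i IH => [|i] IH /=.
  by rewrite exprS !mul0r.
by rewrite coef_deriv IH exprS -[LHS]mulr_natl mulrA.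
Qed.

(** Each application of [euler_op] lowers the order of the zero at [w] by one and contributes the
    factor [w] times the current order. *)
Lemma iter_euler_root j w q :
  (iter j euler_op (('X - w%:P) ^+ j * q)).[w] = j`!%:R * w ^+ j * q.[w].
Proof.
elim: j q => [|j IH] q; first by rewrite /= !expr0 !mul1r.
have step : euler_op (('X - w%:P) ^+ j.+1 * q) =
    ('X - w%:P) ^+ j * ('X * q * j.+1%:R%:P + ('X - w%:P) * ('X * q^`())).
  rewrite /euler_op derivM deriv_exp derivXsubC/= mul1r exprS.
  by rewrite -[_ ^+ _ *+ _]mulr_natr -polyC_natr; ring.
rewrite iterSr step IH !(hornerD, hornerM, hornerX, hornerC, hornerN).
rewrite subrr mul0r addr0.
by rewrite factS natrM exprS; ring.
Qed.

Lemma iter_euler_root0 j m w q : (j < m)%N ->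
  (iter j euler_op (('X - w%:P) ^+ m * q)).[w] = 0.
Proof.
move=> jm; rewrite -(subnKC (ltnW jm)) exprD -mulrA iter_euler_root hornerM.
by rewrite horner_exp hornerXsubC subrr expr0n subn_eq0 leqNgt jm mul0r mulr0.
Qed.

Definition poly_pairing p (x : nat -> K) : K := \sum_(i < size p) p`_i * x i.

(** Iterating [euler_op] multiplies the coefficient of degree [i + 1] by [(i+1)^j]; the factor ['X]
    accounts for entry [i] having index [i + 1]. *)
Lemma poly_pairing_hseq p j z :
  poly_pairing p (fun n => n.+1%:R ^+ j * z ^+ n.+1) =
  (iter j euler_op ('X * p)).[z].
Proof.
rewrite (horner_coef_wide (n := (size p).+1)); last first.
  apply/leq_sizeP => i ip; rewrite coef_iter_euler coefXM.
  case: i ip => // i ip; rewrite nth_default ?mulr0//=.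
rewrite big_ord_recl coef_iter_euler coefXM/= mulr0 mul0r add0r.
apply: eq_bigr => i _; rewrite coef_iter_euler coefXM/= /bump/= add1n.
by rewrite mulrA [_ * p`_i]mulrC.
Qed.

Lemma poly_pairing_sum p (s : seq (K * seq_space K)) :
  poly_pairing p (\sum_(a <- s) a.1 *: a.2) =
  \sum_(a <- s) a.1 * poly_pairing p a.2.
Proof.
elim: s => [|a s IH].
  by rewrite !big_nil /poly_pairing big1// => i _; rewrite mulr0.
rewrite !big_cons -IH /poly_pairing big_distrr -big_split/=.
by apply: eq_bigr => i _; rewrite mulrDr mulrCA.
Qed.

Lemma hseq_notin_span (S : set (seq_space K)) k w : w != 0 ->
  (forall x, S x -> exists j z,
     (j <= k)%N /\ x = fun n => n.+1%:R ^+ j * z ^+ n.+1) ->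
  (fun n => n.+1%:R ^+ k.+1 * w ^+ n.+1 : K) \notin lspan S.
Proof.
move=> w0 SE; apply/negP => /asboolP[s sS ws].
have [zs zsP] : exists zs : seq K, forall a, a \in s -> exists j z,
    [/\ (j <= k)%N, z \in zs & a.2 = fun n => n.+1%:R ^+ j * z ^+ n.+1].
  elim: s sS {ws} => [|a s IH] sS; first by exists [::].
  have [|zs zsP] := IH; first by move=> b bs; apply: sS; rewrite inE bs orbT.
  have [j [z [jk az]]] := SE _ (sS a (mem_head _ _)).
  exists (z :: zs) => b; rewrite inE => /orP[/eqP ->|/zsP[i [y [ik yzs bE]]]].
    by exists j, z; rewrite mem_head.
  by exists i, y; rewrite inE yzs orbT.
(* [Q] is nonzero at [w], so [p] has a zero of order exactly [k + 1] there, and of at least that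
   order at the other points of [zs]. *)
pose Q := \prod_(z <- zs | z != w) ('X - z%:P) ^+ k.+1.
pose p := ('X - w%:P) ^+ k.+1 * Q.
have := congr1 (poly_pairing p) ws.
rewrite poly_pairing_hseq poly_pairing_sum big_seq big1 => [/eqP|a /zsP].
  (* The pairing with the left-hand side is [(k+1)! * w^(k+1) * w * Q(w)], a product of nonzero
     factors. *)
  rewrite /p mulrCA iter_euler_root !mulf_eq0 pnatr_eq0 eqn0Ngt fact_gt0 expf_eq0/=.
  rewrite hornerM hornerX mulf_eq0 (negbTE w0)/=.
  rewrite horner_prod prodf_seq_eq0 => /hasP[z _ /andP[zw]].
  by rewrite horner_exp hornerXsubC expf_eq0 subr_eq0 eq_sym (negbTE zw) andbF.
(* As [j <= k], the zero of order at least [k + 1] at [z] kills the pairing. *)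
move=> [j [z [jk zzs ->]]]; rewrite poly_pairing_hseq.
have [zw|zw] := eqVneq z w.
  by rewrite zw /p mulrCA iter_euler_root0// mulr0.
rewrite /p /Q (big_rem z)//= zw mulrCA [_ * (_ ^+ _ * _)]mulrCA mulrCA.
by rewrite iter_euler_root0// mulr0.
Qed.
End linear_independence.

(** * Functionals determined by finitely many coordinates *)

Section finitely_determined_functional.
Context {K : fieldType} {V : lmodType K}.

(* Induction on [N]: if some [x0] has coordinates [0, ..., 0, 1], subtracting
   [f x0] times the last coordinate from [f] reduces to [N] coordinates;
   otherwise the first [N] coordinates already determine [f]. *)
Lemma functional_coordinates (e : nat -> V -> K^o) (f : V -> K^o) N :
  (forall n, linear (e n)) -> linear f ->
  (forall x, (forall n, (n < N)%N -> e n x = 0) -> f x = 0) ->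
  exists c : nat -> K, forall x, f x = \sum_(n < N) c n * e n x.
Proof.
move=> e_lin; elim: N f => [|N IH] f f_lin fN.
  by exists (fun=> 0) => x; rewrite big_ord0 fN.
have [[x0 [x0N x01]]|noX] := pselect (exists x0,
    (forall n, (n < N)%N -> e n x0 = 0) /\ e N x0 != 0).
  have [||c cP] := IH (fun x => f x - f x0 / e N x0 * e N x).
  - move=> a x y; rewrite f_lin e_lin.
    change (a * f x + f y - f x0 / e N x0 * (a * e N x + e N y) =
      a * (f x - f x0 / e N x0 * e N x) + (f y - f x0 / e N x0 * e N y)).
    ring.
  - move=> x xN.
    (* This multiple of [x0] cancels coordinate [N] of [x] and leaves the earlier ones zero. *)
    have : f (- (e N x / e N x0) *: x0 + x) = 0.
      apply: fN => n; rewrite ltnS leq_eqVlt e_lin => /orP[/eqP ->|nN].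
        by change (- (e N x / e N x0) * e N x0 + e N x = 0); field.
      by rewrite (x0N n)// (xN n)// scaler0 addr0.
    rewrite f_lin; change (- (e N x / e N x0) * f x0 + f x = 0 ->
      f x - f x0 / e N x0 * e N x = 0) => <-; ring.
  exists (fun n => if n == N then f x0 / e N x0 else c n) => x.
  rewrite big_ord_recr/= eqxx -[LHS](subrK (f x0 / e N x0 * e N x)) cP.
  by congr (_ + _); apply: eq_bigr => i _; rewrite ltn_eqF.
have [//||c cP] := IH f.
  move=> x xN; apply: fN => n; rewrite ltnS leq_eqVlt => /orP[/eqP ->|]; last exact: xN.
  by apply/eqP; apply/negP => xN0; apply: noX; exists x; split => //; apply/negP.
exists (fun n => if n == N then 0 else c n) => x.
rewrite big_ord_recr/= eqxx mul0r addr0 cP.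
by apply: eq_bigr => i _; rewrite ltn_eqF.
Qed.
End finitely_determined_functional.

(** * Limits and continuous functionals on a span of sequences *)

Section span_space_of_sequences.
Context {K : numFieldType} {S : set (seq_space K)}.

(** The induced product topology makes convergence coordinatewise, provided that the limit lies in
    the span. *)
Lemma span_space_cvgP {T : Type} {F : set_system T} {FF : Filter F}
    (g : T -> span_space S) (x : span_space S) :
  g @ F --> x <-> forall n, (fun t => val (g t) n : K^o) @ F --> (val x n : K^o).
Proof.
have gE : g @ F --> x <-> (val \o g) @ F --> (val x : seq_space K).
  split=> [gx|vgx].
    by have vx := @span_val_continuous K _ S x; move=> A /vx; exact: gx.
  move=> A [_ [[W Wop <-] Wx WA]]; apply: filterS WA _.
  exact: (vgx W (open_nbhs_nbhs (conj Wop Wx))).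
by rewrite gE; exact: seq_space_cvgP.
Qed.

Lemma val_spanB (x y : span_space S) n : val (x - y) n = val x n - val y n.
Proof. by rewrite raddfB. Qed.

Lemma val_span_linear n : linear (fun x : span_space S => val x n : K^o).
Proof. by move=> a x y; rewrite linearP. Qed.

Lemma val_spanZ a (x : span_space S) n : val (a *: x) n = a *: (val x n : K^o).
Proof. by rewrite -[a *: x]addr0 (val_span_linear n a x 0) raddf0 addr0. Qed.

Lemma val_series (u : nat -> span_space S) N n :
  val (series u N) n = series (fun m => val (u m) n : K^o) N.
Proof.
elim: N => [|N IH]; first by rewrite /series/= !big_geq// raddf0.
by rewrite !seriesSr -IH raddfD.
Qed.

(* A continuous functional is bounded by [1] on a neighbourhood of [0], which
   contains a subspace [x_0 = ... = x_(N-1) = 0]; it vanishes there by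
   homogeneity. *)
Lemma continuous_functional_coordinates (f : {linear span_space S -> K^o}) :
  continuous f -> exists N (c : nat -> K^o), forall x,
    f x = \sum_(n < N) c n * val x n.
Proof.
move=> fc.
(* The filter generated by these subspaces converges to 0, so one of them lies in the preimage of
   the unit ball. *)
pose F := filter_from [set: nat]
  (fun N => [set x : span_space S | forall n, (n < N)%N -> val x n = 0]).
have FF : Filter F.
  apply: filter_from_filter; first by exists 0%N.
  move=> N N' _ _; exists (maxn N N') => // x xN; split=> n nN; apply: xN.
    by rewrite leq_max nN.
  by rewrite leq_max nN orbT.
have F0 : id @ F --> (0 : span_space S).
  apply/span_space_cvgP => n; rewrite raddf0.
  by move=> A A0; exists n.+1 => // x xn; rewrite /= xn//; exact: nbhs_singleton A0.
have : (id @ F) (f @^-1` [set y | `|y| < 1]).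
  apply: F0; apply: fc; rewrite linear0.
  exact: (nbhs0_lt (V := K^o)).
move=> [N _ fN]; exists N.
apply: (@functional_coordinates K (span_space S) (fun n x => val x n) f N).
- exact: val_span_linear.
- by move=> a x y; rewrite linearP.
move=> x xN; apply/eqP; rewrite -normr_eq0; apply/negP => /negP fx0.
suff : `|f ((f x)^-1 *: x)| < 1.
  rewrite linearZ/=; change (~ (`|(f x)^-1 * f x| < 1)).
  by rewrite mulVf ?normr1 ?ltxx// -normr_eq0.
apply: (fN ((f x)^-1 *: x)) => n nN.
by rewrite val_spanZ (xN n nN) scaler0.
Qed.
End span_space_of_sequences.

(** * Curves in [E_k] with exponential coordinates *)

Section exponential_curves.
Context {R : realType} {M : set (Cplx R)} {k : nat}.
Implicit Types (z h : Cplx R) (f : Cplx R -> Espace M k).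

(** Intended for [j <= k] and [M (cexp z)]; the default 0 is taken off the span. *)
Definition exp_curve (j : nat) z : Espace M k :=
  insubd 0 ((fun n => exp_entry n j z) : seq_space R[i]).

Lemma exp_curve0 : exp_curve 0 = expmap M k.
Proof.
apply/funext => z; rewrite /exp_curve /expmap; congr insubd.
by apply/funext => n; rewrite /exp_entry expr0 mul1r.
Qed.

Lemma exp_entry_hseq j z : hseq j (cexp z) = fun n => exp_entry n j z.
Proof. by apply/funext => n; rewrite /hseq -cexpMn. Qed.

Lemma val_exp_curve j z n : (j <= k)%N -> M (cexp z) ->
  val (exp_curve j z) n = exp_entry n j z.
Proof.
move=> jk Mz; rewrite insubdK//; apply/asboolP.
exists [:: (1, hseq j (cexp z))]; last by rewrite big_seq1 scale1r exp_entry_hseq.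
by move=> p; rewrite inE => /eqP -> /=; exists j, (cexp z).
Qed.

Context {U : set (Cplx R)} (openU : open U).

Lemma near_shift_open z (P : Cplx R -> Prop) : U z -> (forall w, U w -> P w) ->
  \forall h \near (0 : Cplx R), P (z + h).
Proof.
move=> Uz UP.
have : \forall w \near z, U w by apply: open_nbhs_nbhs.
rewrite (near_shift (0 : Cplx R)); apply: filterS => h.
by rewrite /= subr0 addrC => /UP.
Qed.

Lemma exp_curve_continuous f j : (forall z n, U z -> val (f z) n = exp_entry n j z) ->
  {within U, continuous f}.
Proof.
move=> fE; rewrite continuous_open_subspace// => z /set_mem Uz.
apply/(@span_space_cvgP _ _ _ (nbhs z)) => n; rewrite fE//.
apply: (@cvg_near_eq _ _ (nbhs z) _ (exp_entry n j)); last exact: exp_entry_continuous.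
have : \forall w \near z, U w by apply: open_nbhs_nbhs.
by apply: filterS => w Uw; rewrite fE.
Qed.

(** The coordinates of the difference quotient always converge, so only membership of their limit in
    [E_k] is at stake. With [f] arbitrary, this also applies to the maps supplied by [CkC]. *)
Lemma is_cderive_exp_curve f j z (l : Espace M k) :
  (forall z n, U z -> val (f z) n = exp_entry n j z) -> U z ->
  is_cderive f z l <-> forall n, val l n = exp_entry n j.+1 z.
Proof.
move=> fE Uz.
have quotE n : (fun h => val ((h : R[i])^-1 *: (f (z + h) - f z)) n : Cplx R)
    @ (0 : Cplx R)^' --> exp_entry n j.+1 z.
  apply: (@cvg_near_eq _ (Cplx R) (0 : Cplx R)^' _ (fun h => (h : R[i])^-1 *
    (exp_entry n j (z + h) - exp_entry n j z))); last exact: exp_entry_derive.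
  have : \forall h \near (0 : Cplx R)^', forall n, val (f (z + h)) n = exp_entry n j (z + h).
    by apply: nbhs_dnbhs; apply: (near_shift_open (P := fun w =>
      forall n, val (f w) n = exp_entry n j w)) => // w Uw m; rewrite fE.
  apply: filterS => h fh; rewrite val_spanZ val_spanB.
  by rewrite fh -(fE z).
split=> [fl n|lE].
  have /span_space_cvgP/(_ n) fln := fl.
  by apply: (cvg_unique _ fln (quotE n)); exact: norm_hausdorff.
by apply/span_space_cvgP => n; rewrite lE; exact: quotE.
Qed.
End exponential_curves.

(** * Regularity of [expmap] *)

Section regularity.
Context {R : realType} {U M : set (Cplx R)} {k : nat} (openU : open U).
Context (expU_M : [set cexp z | z in U] `<=` M) (M_neq0 : M `<=` ~` [set 0]).

Let expM z : U z -> M (cexp z).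
Proof. by move=> Uz; apply: expU_M; exists z. Qed.

Let val_expmapE z n : U z -> val (expmap M k z) n = exp_entry n 0 z.
Proof. by move=> Uz; rewrite -exp_curve0 val_exp_curve//; exact: expM. Qed.

Lemma expmap_CkC : CkC k U (expmap M k).
Proof.
exists exp_curve; split=> [|j jk z Uz|j jk]; first exact: exp_curve0.
  apply/(is_cderive_exp_curve openU (j := j)) => // [w n Uw|n].
    by rewrite val_exp_curve ?(ltnW jk)//; exact: expM.
  by rewrite val_exp_curve//; exact: expM.
apply: (exp_curve_continuous openU (j := j)) => z n Uz.
by rewrite val_exp_curve//; exact: expM.
Qed.

Lemma exp_entry_notin_span z : U z ->
  ((fun n => exp_entry n k.+1 z) : seq_space R[i]) \notin lspan (hset M k).
Proof.
move=> Uz; rewrite -exp_entry_hseq; apply: hseq_notin_span.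
  by apply/eqP => w0; exact: (M_neq0 (expM Uz)).
by move=> x [j [w [jk _ ->]]]; exists j, w.
Qed.

Lemma expmap_not_CkC : U !=set0 -> ~ CkC k.+1 U (expmap M k).
Proof.
move=> [z0 Uz0] [g [g0 gder _]].
(* The coordinates of [g j] are forced, whereas [g k.+1 z0] lies in [E_k] by its type. *)
have gE j : (j <= k.+1)%N -> forall z n, U z -> val (g j z) n = exp_entry n j z.
  elim: j => [|j IH] jk z n Uz; first by rewrite g0 val_expmapE.
  exact: (proj1 (is_cderive_exp_curve openU _ (IH (ltnW jk)) Uz) (gder _ jk _ Uz) n).
have /negP := exp_entry_notin_span Uz0; apply.
have -> : ((fun n => exp_entry n k.+1 z0) : seq_space R[i]) = val (g k.+1 z0).
  by apply/funext => n; rewrite gE.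
exact: valP.
Qed.

Lemma expmap_not_analytic : U !=set0 -> ~ complex_analytic U (expmap M k).
Proof.
move=> [z0 Uz0] [_ /(_ _ Uz0)[a az]].
(* Each coordinate of the expansion is a scalar power series, so uniqueness gives its Taylor
   coefficients. *)
have coefE m n : val (a m) n = exp_entry n 0 z0 * (n.+1%:R ^+ m * inv_fact R[i] m).
  apply: (pseries_uniq (b := fun m => val (a m) n) _ (exp_entry_series_near n 0 z0)).
  apply: nbhs_dnbhs.
  have : \forall z \near z0, U z /\
      series (fun m => (z - z0 : R[i]) ^+ m *: a m) @ \oo --> expmap M k z.
    by apply: filterI az; apply: open_nbhs_nbhs.
  rewrite (near_shift (0 : Cplx R)); apply: filterS => h /=.
  rewrite subr0 addrK [h + _]addrC => -[Uh /span_space_cvgP/(_ n)].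
  rewrite val_expmapE//.
  under eq_fun do rewrite val_series.
  rewrite /pseries_to.
  by under [in X in X -> _]eq_fun do under eq_fun do rewrite val_spanZ.
have /negP := exp_entry_notin_span Uz0; apply.
(* The factorial cancels [inv_fact], so the forbidden sequence would be a multiple of an element of
   [E_k]. *)
have -> : ((fun n => exp_entry n k.+1 z0) : seq_space R[i]) =
    k.+1`!%:R *: val (a k.+1).
  apply/funext => n.
  change (exp_entry n k.+1 z0 = k.+1`!%:R * val (a k.+1) n).
  rewrite coefE /inv_fact /exp_entry expr0 mul1r.
  by field; rewrite pnatr_eq0 -lt0n fact_gt0.
by apply: rpredZ; exact: valP.
Qed.

Lemma expmap_weakly_analytic : weakly_analytic U (expmap M k).
Proof.
have fc : {within U, continuous (expmap M k)}.
  by apply: (exp_curve_continuous openU (j := 0)) => z n; exact: val_expmapE.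
split=> // f cf; split.
  move=> z; apply: (@continuous_comp (subspace U) _ _ (expmap M k) f).
    exact: fc.
  exact: cf.
move=> z0 Uz0.
have [N [c fE]] := continuous_functional_coordinates cf.
(* [N] and [c] do not depend on [z], so the Taylor coefficients combine with weights [c n]. *)
exists (fun m => \sum_(n < N) c n * (exp_entry n 0 z0 * (n.+1%:R ^+ m * inv_fact R[i] m))).
have : \forall z \near z0, U z by apply: open_nbhs_nbhs.
apply: filterS => z Uz.
rewrite /= fE; under eq_bigr do rewrite val_expmapE//.
pose b n m : Cplx R := exp_entry n 0 z0 * (n.+1%:R ^+ m * inv_fact R[i] m).
have bz (n : 'I_N) : pseries_to (b n) (z - z0) (exp_entry n 0 z).
  by have := @exp_entry_series R n 0 z0 (z - z0); rewrite [z0 + _]addrC subrK.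
exact: (@pseries_lincomb R[i] N c b (z - z0) (fun n => exp_entry n 0 z) bz).
Qed.
End regularity.

Theorem theorem1p1 (R : realType) (U M : set (Cplx R)) (openU : open U)
    (U_neq0 : U !=set0) (M_neq0 : M `<=` ~` [set 0])
    (expU_M : [set cexp z | z in U] `<=` M) :
  (forall k : nat, (0 < k)%N ->
    [/\ CkC k U (expmap M k), ~ CkC k.+1 U (expmap M k) &
        ~ complex_analytic U (expmap M k)]) /\
  [/\ weakly_analytic U (expmap M 0%N), ~ CkC 1%N U (expmap M 0%N) &
      ~ complex_analytic U (expmap M 0%N)].
Proof.
split=> [k _|]; split.
- exact: expmap_CkC.
- exact: expmap_not_CkC.
- exact: expmap_not_analytic.
- exact: expmap_weakly_analytic.
- exact: expmap_not_CkC.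
- exact: expmap_not_analytic.
Qed.
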